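(* Let $F(x,y)=a_nx^n+a_{n-1}x^{n-1}y+\cdots+a_0y^n\in\mathbf Z[x,y]$ be a homogeneous polynomial of degree $n$ with irreducible factorization $F(x,y)=\prod_{j=1}^uF_j(x,y)$, and let $g=\gcd(a_n,\dots,a_0)$. Let $N$ be an integer of the form \[N=g\,p_1\cdots p_s\,q_1^{l_1}\cdots q_t^{l_t},\] where $q_1,\dots,q_t$ are distinct primes belonging to $\bigcap_{j=1}^u\mathbf P(\mathcal C_{F_j})$ such that, for each $i$, $\gcd(q_i,a_n\Delta_{F,mod})=1$ or $\gcd(q_i,a_0\Delta_{F,mod})=1$, and $p_1,\dots,p_s$ are primes not of this kind. If $N$ is represented by $F(x,y)$ (i.e. $N=F(x,y)$ for some $(x,y)\in\mathbf Z^2$), then $n\mid l_i$ for all $i$.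
   Context: $\Delta_F$ is the discriminant of $F(x,1)$ and $\Delta_{F,mod}=\Delta_F/g^{2n-2}$. For a polynomial $G(x,y)\in\mathbf Z[x,y]$, let $K_G$ be the splitting field of $G(x,1)$ over $\mathbf Q$, with $\mathrm{Gal}(K_G/\mathbf Q)$ viewed as a permutation group on the roots of $G(x,1)$; $\mathcal C_G$ is the set of conjugacy classes of $\mathrm{Gal}(K_G/\mathbf Q)$ all of whose cycle lengths in this action are $\ge2$. For a conjugacy class $C$, $\mathbf P(C)$ is the set of primes $p$ unramified in $K_G$ with Frobenius $(p,K_G/\mathbf Q)\in C$, and $\mathbf P(\mathcal C_G)=\bigcup_{C\in\mathcal C_G}\mathbf P(C)$.
   Formalization: The formal theorem assumes a_n ≠ 0, so F(x,1) has degree n; without this the claim fails, e.g. F = y(x²+y²), q = 3, F(1,3) = 30 = 2·5·3, where the factor y has no roots in F(x,1) and imposes no condition. *)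

(* Defs.v *)
From mathcomp Require Import all_boot all_order all_algebra.
From mathcomp Require Import all_fingroup all_field.
From mathcomp Require Import classical_sets.
From mathcomp Require Import mpoly.

Set Implicit Arguments.
Unset Strict Implicit.
Unset Printing Implicit Defensive.

Import GRing.Theory Num.Theory.
Local Open Scope ring_scope.

(* ['X_0] plays the role of [x] and ['X_1] that of [y]. *)
Definition binary_form (n : nat) (a : 'I_n.+1 -> int) : {mpoly int[2]} :=
  \sum_(i < n.+1) (a i)%:MP * 'X_0 ^+ i * 'X_1 ^+ (n - i).

Definition form_content (n : nat) (a : 'I_n.+1 -> int) : int :=
  \big[gcdz/0]_(i < n.+1) a i.

Definition eval2 (G : {mpoly int[2]}) (x y : int) : int :=
  G.@[tnth [tuple x; y]].

Definition dehomog (G : {mpoly int[2]}) : {poly int} :=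
  mmap (@polyC int) (tnth [tuple 'X; 1]) G.

Definition irreducible_elt (R : idomainType) (f : R) : Prop :=
  [/\ f != 0, f \isn't a GRing.unit &
      forall a b : R, f = a * b -> a \is a GRing.unit \/ b \is a GRing.unit].

(* (-1)^(d(d-1)/2) Res(f, f') / lead_coef f with d = deg f; the division is
   exact because the last column of the Sylvester matrix is divisible by the
   leading coefficient of f. *)
Definition discriminant (f : {poly int}) : int :=
  (((-1) ^+ 'C((size f).-1, 2) * resultant f f^`()) %/ lead_coef f)%Z.

(* The quotient is exact when [a ord_max != 0], the discriminant being
   homogeneous of degree 2n-2 in the coefficients. *)
Definition discriminant_mod (n : nat) (a : 'I_n.+1 -> int) : int :=
  (discriminant (dehomog (binary_form a)) %/ form_content a ^+ (2 * n - 2))%Z.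

Section NumberField.
Variable K : splittingFieldType rat.

Definition ring_of_integers : set K :=
  [set x | integralOver (intr : int -> K) x]%classic.
Local Notation OK := ring_of_integers.

Definition is_ideal (I : set K) : Prop :=
  [/\ (I `<=` OK)%classic, I 0, forall x y, I x -> I y -> I (x + y)
    & forall x y, OK x -> I y -> I (x * y)].

Definition is_prime_ideal (P : set K) : Prop :=
  [/\ is_ideal P, ~ P 1
    & forall x y, OK x -> OK y -> P (x * y) -> P x \/ P y].

Definition ideal_mul (I J : set K) : set K :=
  [set z | exists (m : nat) (x y : 'I_m -> K),
     [/\ forall i, I (x i), forall i, J (y i) & z = \sum_i x i * y i]]%classic.

Definition principal_ideal (c : K) : set K :=
  [set z | exists2 x, OK x & z = c * x]%classic.

Definition unramified (p : nat) : Prop :=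
  exists (r : nat) (P : 'I_r -> set K),
    [/\ injective P, forall i, is_prime_ideal (P i)
      & principal_ideal p%:R = \big[ideal_mul/OK]_(i < r) P i].

Definition is_frobenius_at (p : nat) (P : set K)
    (sigma : gal_of {:K}) : Prop :=
  forall x, OK x -> P (sigma x - x ^+ p).

(* The Frobenius elements at the primes above p; when p is unramified in K this
   is one conjugacy class, the Artin symbol (p, K/Q). *)
Definition frobenius (p : nat) (sigma : gal_of {:K}) : Prop :=
  sigma \in 'Gal({:K} / 1)%g /\
  exists P : set K,
    [/\ is_prime_ideal P, P p%:R & is_frobenius_at p P sigma].

Definition primes_of_class (C : {set gal_of {:K}}) (p : nat) : Prop :=
  [/\ prime p, unramified p & exists2 sigma, frobenius p sigma & sigma \in C].

(* The cycle of sigma through r is the orbit of r under <[sigma]>. *)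
Definition cycle_length (sigma : gal_of {:K}) (r : K) : nat :=
  size (undup [seq (tau : gal_of {:K}) r | tau <- enum <[sigma]>%g]).

Definition derangement_class (G : {mpoly int[2]})
    (C : {set gal_of {:K}}) : Prop :=
  C \in classes 'Gal({:K} / 1)%g /\
  forall sigma r, sigma \in C -> root (map_poly intr (dehomog G)) r ->
    (2 <= cycle_length sigma r)%N.

(* P(C_G), where K is meant to be a splitting field of G(x,1). *)
Definition derangement_primes (G : {mpoly int[2]}) (p : nat) : Prop :=
  exists2 C, derangement_class G C & primes_of_class C p.

Definition is_splitting_field_of (G : {mpoly int[2]}) : Prop :=
  splittingFieldFor 1 (map_poly intr (dehomog G)) {:K}.

End NumberField.

Definition admissible_prime (n : nat) (a : 'I_n.+1 -> int) (u : nat)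
    (Fj : 'I_u -> {mpoly int[2]}) (K : 'I_u -> splittingFieldType rat)
    (q : nat) : Prop :=
  [/\ prime q,
      forall j, derangement_primes (K j) (Fj j) q
    & coprimez q%:Z (a ord_max * discriminant_mod a) \/
      coprimez q%:Z (a ord0 * discriminant_mod a)].

(* Main.v *)
(** After removing a common factor q^n it suffices to show that an admissible
    prime q divides F(x,y) only if it divides both x and y.  Otherwise some
    irreducible factor has a zero (x:y) in P^1(F_q), and if q does not divide
    its leading (or its constant) coefficient, then up to integers prime to q it
    is a product of linear factors U(r) X - V(r), indexed by the roots r, with
    integral U(r), V(r).  At (x:y) one of these values lies in a prime P above
    q; its image under the Frobenius element at P, which is the value of the
    factor of sigma(r) <> r, also lies in P.  So the zero is double modulo q,
    and q divides the discriminant, a contradiction.  The discriminant is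
    treated as the determinant of a reduced Sylvester matrix, which makes sense
    also when q divides the leading coefficient of F(x,1). *)
Require Import Defs.
From mathcomp Require Import all_boot all_order all_algebra.
From mathcomp Require Import all_fingroup all_field.
From mathcomp Require Import classical_sets.
From mathcomp Require Import mpoly zify ring.

Set Implicit Arguments.
Unset Strict Implicit.
Unset Printing Implicit Defensive.

Import GRing.Theory Num.Theory.
Local Open Scope ring_scope.

(* [lia] abstracts terms syntactically and would otherwise distinguish
   occurrences of [size f] whose implicit arguments are merely convertible. *)
Ltac slia :=
  let R := constr:(int : nzSemiRingType) in
  let R := eval cbv beta delta [reverse_coercion] in R in
  repeat match goal with
  | |- context [@deriv ?S ?p] =>
      assert_fails (constr_eq_strict S R); change (@deriv S p) with (@deriv R p)
  | |- context [@polyseq ?S ?p] =>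
      assert_fails (constr_eq_strict S R);
      change (@polyseq S p) with (@polyseq R p)
  | |- context [@size ?T ?s] =>
      assert_fails (constr_eq_strict T int); change (@size T s) with (@size int s)
  | H : context [@deriv ?S ?p] |- _ =>
      assert_fails (constr_eq_strict S R);
      change (@deriv S p) with (@deriv R p) in H
  | H : context [@polyseq ?S ?p] |- _ =>
      assert_fails (constr_eq_strict S R);
      change (@polyseq S p) with (@polyseq R p) in H
  | H : context [@size ?T ?s] |- _ =>
      assert_fails (constr_eq_strict T int);
      change (@size T s) with (@size int s) in H
  end; lia.

(** * The discriminant and double roots *)

Lemma size_deriv_int (f : {poly int}) : size f^`() = (size f).-1.
Proof.
case: (ltngtP (size f) 1) => [|hf|/eqP/size_poly1P[c _ ->]].
- by rewrite ltnS leqn0 size_poly_eq0 => /eqP->; rewrite deriv0 size_poly0.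
- have f0 : f != 0 by rewrite -size_poly_gt0 ltnW.
  apply/eqP; rewrite eqn_leq -ltnS prednK ?(ltnW hf) //.
  rewrite lt_size_deriv //= leqNgt; apply/negP => hlt.
  have: f^`()`_(size f).-2 = 0 by apply: nth_default; slia.
  rewrite coef_deriv (_ : (size f).-2.+1 = (size f).-1); last by slia.
  by move/eqP; rewrite mulrn_eq0 -lead_coefE lead_coef_eq0 (negPf f0); slia.
- by rewrite derivC size_poly0 size_polyC; case: (c != 0).
Qed.

(** Treats the two blocks of the Sylvester matrix uniformly, so that claims about columns become
    claims about coefficients of shifted polynomials. *)
Lemma Sylvester_rowP (R : nzRingType) (p q : {poly R})
    (i : 'I_((size q).-1 + (size p).-1)) :
  exists k r, [/\ (r = p /\ (k < (size q).-1)%N) \/ (r = q /\ (k < (size p).-1)%N)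
    & forall j, Sylvester_mx p q i j = ('X^k * r)`_j].
Proof.
have := Sylvester_mxE i; case: (split i) => k E; exists (val k).
  exists p; split=> [|j]; first by left; split=> //; exact: ltn_ord.
  by rewrite E coefXnM; case: ltnP.
exists q; split=> [|j]; first by right; split=> //; exact: ltn_ord.
by rewrite E coefXnM; case: ltnP.
Qed.

(** Applying the matrix to the column of powers of [e] evaluates each row polynomial [X^k p] or
    [X^k q] at [e]. *)
Lemma Sylvester_horner (p q : {poly int}) (d e : int)
    (i : 'I_((size q).-1 + (size p).-1)) :
  (d %| p.[e])%Z -> (d %| q.[e])%Z ->
  (d %| \sum_j Sylvester_mx p q i j * e ^+ j)%Z.
Proof.
move=> dp dq; have [k [r [hr E]]] := Sylvester_rowP i.
under eq_bigr do rewrite E.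
rewrite -horner_coef_wide.
  by rewrite hornerM dvdz_mull //; case: hr => [[->]|[->]].
rewrite mulrC; apply: leq_trans (size_polyMleq _ _) _; rewrite size_polyXn.
by case: hr => [[-> ?]|[-> ?]]; slia.
Qed.

(* [discriminant f] is, up to sign, the determinant of the Sylvester matrix of
   [f] and [f'] with its last column divided by [lead_coef f]. *)
Definition disc_mx (f : {poly int}) :
    'M[int]_((size f^`()).-1 + (size f).-1) :=
  \matrix_(i, j) if j.+1 == ((size f^`()).-1 + (size f).-1)%N
    then (Sylvester_mx f f^`() i j %/ lead_coef f)%Z
    else Sylvester_mx f f^`() i j.

Definition disc_scale (f : {poly int}) :
    'rV[int]_((size f^`()).-1 + (size f).-1) :=
  \row_j if j.+1 == ((size f^`()).-1 + (size f).-1)%N then lead_coef f else 1.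

Lemma disc_mxE (f : {poly int}) i j : disc_mx f i j =
  if j.+1 == ((size f^`()).-1 + (size f).-1)%N
    then (Sylvester_mx f f^`() i j %/ lead_coef f)%Z
    else Sylvester_mx f f^`() i j.
Proof. by rewrite [LHS]mxE. Qed.

Lemma disc_scaleE (f : {poly int}) i j : disc_scale f i j =
  if j.+1 == ((size f^`()).-1 + (size f).-1)%N then lead_coef f else 1.
Proof. by rewrite mxE. Qed.

(** The last column reads [f] or [f'] at its degree or above, so an entry is 0, [lead_coef f], or
    [deg f] times it. *)
Lemma Sylvester_deriv_last (f : {poly int}) (i j : 'I__) :
  j.+1 = ((size f^`()).-1 + (size f).-1)%N ->
  (lead_coef f %| Sylvester_mx f f^`() i j)%Z.
Proof.
move=> hj; have [k [r [hr ->]]] := Sylvester_rowP i.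
rewrite coefXnM; case: ltnP => // hk; have := size_deriv_int f.
case: hr => [[-> hk']|[-> hk']] hs.
  have [E|h] := eqVneq (j - k)%N (size f).-1; first by rewrite E.
  by rewrite nth_default //; slia.
rewrite coef_deriv; have [E|h] := eqVneq (j - k).+1 (size f).-1.
  by rewrite E -mulr_natr dvdz_mulr.
by rewrite nth_default ?mul0rn //; slia.
Qed.

Lemma Sylvester_deriv_factor (f : {poly int}) : f != 0 ->
  Sylvester_mx f f^`() = disc_mx f *m diag_mx (disc_scale f).
Proof.
move=> f0; apply/matrixP => i j.
rewrite mul_mx_diag [RHS]mxE disc_mxE disc_scaleE.
case: eqP => [h|_]; last by rewrite mulr1.
by rewrite divzK //; apply: Sylvester_deriv_last.
Qed.

Lemma resultant_deriv (f : {poly int}) : (1 < size f)%N ->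
  resultant f f^`() = lead_coef f * \det (disc_mx f).
Proof.
move=> hf; have f0 : f != 0 by rewrite -size_poly_gt0 ltnW.
rewrite /resultant Sylvester_deriv_factor // det_mulmx det_diag mulrC.
have hd : (((size f^`()).-1 + (size f).-1).-1 < (size f^`()).-1 + (size f).-1)%N.
  by slia.
rewrite (bigD1 (Ordinal hd)) //= big1 ?mulr1 => [|j hj].
  by rewrite disc_scaleE /= prednK ?eqxx //; slia.
rewrite disc_scaleE; case: eqP => // h; case/eqP: hj; apply: val_inj => /=.
slia.
Qed.

(** The Sylvester matrix sends the column of powers of [e] to a vector divisible by [d]; the
    adjugate of [disc_mx f] then turns the determinant into an integral combination of its
    entries. *)
Lemma disc_double_root (f : {poly int}) (d e : int) : (2 < size f)%N ->
  (d %| f.[e])%Z -> (d %| f^`().[e])%Z -> (d %| \det (disc_mx f))%Z.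
Proof.
move=> hf df df'; have f0 : f != 0 by rewrite -size_poly_gt0; slia.
pose w : 'cV[int]_((size f^`()).-1 + (size f).-1) := \col_j (e ^+ j).
have hd : (0 < (size f^`()).-1 + (size f).-1)%N by slia.
(* Entry 0 of the column is [e^0 = 1], and column 0 is not the rescaled last one because the matrix
   has size at least 3. *)
have -> : \det (disc_mx f) =
    ((\adj (disc_mx f)) *m (Sylvester_mx f f^`() *m w)) (Ordinal hd) 0.
  rewrite Sylvester_deriv_factor // -(mulmxA (disc_mx f)).
  rewrite (mulmxA (\adj _)) mul_adj_mx.
  rewrite mul_scalar_mx mxE mul_diag_mx !mxE /= expr0 mulr1.
  by have := size_deriv_int f; case: eqP; rewrite ?mulr1 //; slia.
rewrite mxE rpred_sum // => i _; apply: dvdz_mull; rewrite mxE.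
under eq_bigr do rewrite [w _ _]mxE.
exact: Sylvester_horner.
Qed.

(** The case of a double zero at infinity: the last but one column, which [disc_mx] leaves unscaled,
    holds only multiples of the two top coefficients of [f]. *)
Lemma disc_double_root_infty (f : {poly int}) (d : int) : (2 < size f)%N ->
  (d %| lead_coef f)%Z -> (d %| f`_(size f).-2)%Z ->
  (d %| \det (disc_mx f))%Z.
Proof.
move=> hf dl dl'.
have coef_top j : ((size f).-2 <= j)%N -> (d %| f`_j)%Z.
  move=> hj; case: (ltnP j (size f)) => hj'; last by rewrite nth_default.
  have [->|h] := eqVneq j (size f).-1; first exact: dl.
  rewrite (_ : j = (size f).-2) //; slia.
have hs := size_deriv_int f.
have hd : (((size f^`()).-1 + (size f).-1).-2 < (size f^`()).-1 + (size f).-1)%N.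
  by slia.
rewrite (expand_det_col _ (Ordinal hd)) rpred_sum // => i _.
apply: dvdz_mulr; rewrite disc_mxE; case: eqP => [/= h|_]; first by exfalso; slia.
have [k [r [hr ->]]] := Sylvester_rowP i.
rewrite coefXnM /=; case: ltnP => // hk.
case: hr => [[-> hk']|[-> hk']]; first by apply: coef_top; slia.
by rewrite coef_deriv -mulr_natr dvdz_mulr // coef_top //; slia.
Qed.

(** * Prime ideals and Frobenius elements *)

Section PrimeIdeals.
Variable K : splittingFieldType rat.
Local Notation OK := (@ring_of_integers K).

Lemma OK_int (m : int) : OK m%:~R.
Proof. exact: (integral_id (intr : {rmorphism int -> K})). Qed.

Lemma OK_add x y : OK x -> OK y -> OK (x + y).
Proof. exact: (@integral_add _ _ (intr : {rmorphism int -> K})). Qed.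

Lemma OK_mul x y : OK x -> OK y -> OK (x * y).
Proof. exact: (@integral_mul _ _ (intr : {rmorphism int -> K})). Qed.

Lemma OK_opp x : OK x -> OK (- x).
Proof. exact: (@integral_opp _ _ (intr : {rmorphism int -> K})). Qed.

Lemma OK_exp x n : OK x -> OK (x ^+ n).
Proof.
move=> hx; elim: n => [|n IH]; first exact: (OK_int 1).
by rewrite exprS; apply: OK_mul.
Qed.

Definition OK_poly (G : {poly K}) : Prop := forall i, OK G`_i.

Lemma OK_poly_mul G H : OK_poly G -> OK_poly H -> OK_poly (G * H).
Proof.
move=> hG hH i; rewrite coefM.
apply: (big_ind OK) => [||j _]; [exact: (OK_int 0)|exact: OK_add|].
exact: OK_mul.
Qed.

Lemma OK_poly_prod (I : eqType) (s : seq I) (G : I -> {poly K}) :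
  (forall r, r \in s -> OK_poly (G r)) -> OK_poly (\prod_(r <- s) G r).
Proof.
move=> hG; rewrite big_seq; apply: (big_ind OK_poly) => //.
  by move=> i; rewrite coef1; case: (i == _); [exact: (OK_int 1)|exact: (OK_int 0)].
exact: OK_poly_mul.
Qed.

Lemma OK_horner G (e : int) : OK_poly G -> OK G.[e%:~R].
Proof.
move=> hG; rewrite horner_coef.
apply: (big_ind OK) => [||j _]; [exact: (OK_int 0)|exact: OK_add|].
by apply: OK_mul => //; apply: OK_exp; exact: OK_int.
Qed.

Lemma OK_deriv G : OK_poly G -> OK_poly G^`().
Proof.
move=> hG i; rewrite coef_deriv -mulr_natr; apply: OK_mul => //.
exact: (integral_nat (intr : {rmorphism int -> K})).
Qed.

Variables (P : set K) (hP : is_prime_ideal P).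

Lemma P_OK x : P x -> OK x.
Proof. by case: hP => -[h _ _ _] _ _; apply: h. Qed.

Lemma P_add x y : P x -> P y -> P (x + y).
Proof. by case: hP => -[_ _ h _] _ _; apply: h. Qed.

Lemma P_mull x y : OK x -> P y -> P (x * y).
Proof. by case: hP => -[_ _ _ h] _ _; apply: h. Qed.

Lemma P_mulr x y : P x -> OK y -> P (x * y).
Proof. by move=> hx hy; rewrite mulrC; apply: P_mull. Qed.

Lemma P_opp x : P x -> P (- x).
Proof. by move=> hx; rewrite -mulN1r; apply: P_mull (OK_int (-1)) hx. Qed.

Lemma P_prod (I : eqType) (s : seq I) (F : I -> K) :
  (forall r, r \in s -> OK (F r)) -> P (\prod_(r <- s) F r) ->
  exists2 r, r \in s & P (F r).
Proof.
case: hP => _ n1 pr; elim: s => [|r s IH] hF; first by rewrite big_nil.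
rewrite big_cons => /pr[||hr|hs].
- by apply: hF; rewrite mem_head.
- rewrite big_seq; apply: (big_ind OK) => [||j js]; first exact: (OK_int 1).
    exact: OK_mul.
  by apply: hF; rewrite inE js orbT.
- by exists r; rewrite ?mem_head.
case: IH => // [r' h|r' h1 h2]; first by apply: hF; rewrite inE h orbT.
by exists r'; rewrite // inE h1 orbT.
Qed.

Variables (q : nat) (hq : prime q) (hPq : P q%:R).

(** If [q] does not divide [m], a Bezout relation puts 1 in [P]. *)
Lemma P_intE (m : int) : P m%:~R <-> (q %| m)%Z.
Proof.
split=> [hm|/dvdzP[k ->]]; last first.
  by rewrite intrM; apply: P_mull (OK_int k) hPq.
apply/negP => /negP hnd; case: hP => _ n1 _; apply: n1.
have: coprimez q m by rewrite coprimezE prime_coprime.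
case/coprimezP => -[u v] /= E.
rewrite (_ : 1 = 1%:~R) // -E rmorphD !rmorphM /=.
by apply: P_add; apply: P_mull => //; exact: OK_int.
Qed.

Variables (sigma : gal_of {:K}) (hs : is_frobenius_at q P sigma).

(** Both summands of [(sigma z - z^q) + z^q] lie in [P]. *)
Lemma P_frobenius z : P z -> P (sigma z).
Proof.
move=> hz; rewrite -(subrK (z ^+ q) (sigma z)); apply: P_add.
  exact: hs (P_OK hz).
rewrite -(prednK (prime_gt0 hq)) exprS; apply: P_mulr => //.
by apply: OK_exp; apply: P_OK.
Qed.

End PrimeIdeals.

(** * Products of linear factors permuted by a Frobenius element *)

Section LinearFactors.
Variable K : splittingFieldType rat.
Variables (U V : K -> K).
Local Notation OK := (@ring_of_integers K).
Local Notation L r := (U r *: 'X - (V r)%:P).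

Lemma coef_lin_mul r (G : {poly K}) k :
  (L r * G)`_k.+1 = U r * G`_k - V r * G`_k.+1.
Proof. by rewrite mulrBl coefB -scalerAl coefZ coefXM coefCM. Qed.

Lemma OK_poly_lin r : OK (U r) -> OK (V r) -> OK_poly (L r).
Proof.
move=> hU hV [|[|i]]; rewrite coefB coefZ coefX coefC /=.
- by rewrite mulr0 sub0r; apply: OK_opp.
- by rewrite mulr1 subr0.
- by rewrite mulr0 subr0; exact: (OK_int K 0).
Qed.

Lemma size_prod_lin s : (size (\prod_(r <- s) L r)%R <= (size s).+1)%N.
Proof.
apply/leq_sizeP; elim: s => [|r s IH] [|j] //= hj.
  by rewrite big_nil coef1.
by rewrite big_cons coef_lin_mul !IH ?mulr0 ?subr0 // ltnW.
Qed.

(** The formal degree [size s] stands in for the degree, since some [U r] may vanish. *)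
Lemma coef_prod_lin s : (\prod_(r <- s) L r)`_(size s) = \prod_(r <- s) U r.
Proof.
elim: s => [|r s IH]; first by rewrite !big_nil coef1.
rewrite !big_cons /= coef_lin_mul IH [X in _ - _ * X]nth_default ?mulr0 ?subr0 //.
exact: size_prod_lin.
Qed.

Variables (q : nat) (hq : prime q) (P : set K) (hP : is_prime_ideal P).
Variables (hPq : P q%:R) (sigma : gal_of {:K}).
Hypothesis hsig : is_frobenius_at q P sigma.
Variables (rs : seq K).
Hypotheses (hU : forall r, r \in rs -> OK (U r))
  (hV : forall r, r \in rs -> OK (V r))
  (sU : forall r, r \in rs -> sigma (U r) = U (sigma r))
  (sV : forall r, r \in rs -> sigma (V r) = V (sigma r))
  (srs : forall r, r \in rs -> sigma r \in rs)
  (derg : forall r, r \in rs -> sigma r != r).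
(** In use [m] is a power of [beta]: making the linear factors integral costs only integers prime to
    [q]. *)
Variables (f : {poly int}) (m beta : int).
Hypotheses (qm : ~~ (q %| m)%Z) (qbeta : ~~ (q %| beta)%Z)
  (hf : m%:~R *: map_poly intr f = beta%:~R *: \prod_(r <- rs) L r).

Lemma P_int_factor (a : int) x : ~~ (q %| a)%Z -> OK x -> P (a%:~R * x) -> P x.
Proof.
move=> ha hx; case: (hP) => _ _ pr /pr[] //; first exact: OK_int.
by move/(P_intE hP hq hPq)=> h; rewrite h in ha.
Qed.

Lemma dvd_int_factor (a b : int) : ~~ (q %| a)%Z -> P (a%:~R * b%:~R) -> (q %| b)%Z.
Proof.
move=> ha h; apply/(P_intE hP hq hPq).
by apply: P_int_factor ha (OK_int K b) h.
Qed.

(** The absence of fixed roots enters here: as [sigma r] differs from [r], the conjugate factor is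
    still present once the factor of [r] is removed. *)
Lemma prod_lin_split r : r \in rs -> exists s,
  [/\ {subset s <= rs}, size rs = (size s).+2
    & \prod_(r <- rs) L r = L r * (L (sigma r) * \prod_(r <- s) L r)].
Proof.
move=> hr; have hs : sigma r \in rem r rs.
  have := srs hr; rewrite (perm_mem (perm_to_rem hr)) inE.
  by rewrite (negPf (derg hr)).
exists (rem (sigma r) (rem r rs)); split.
- by move=> x /mem_rem/mem_rem.
- have h1 := size_rem hr; have h2 := size_rem hs.
  have : (0 < size (rem r rs))%N by case: (rem r rs) hs.
  by rewrite h2 h1; case: (size rs) => [|[]].
- by rewrite (big_rem r hr) (big_rem _ hs).
Qed.

(** Two distinct factors, those of some [r] and of [sigma r], have values at [e] in [P], so the
    derivative of the product lies in [P] as well. *)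
Lemma frobenius_double_root (e : int) : (q %| f.[e])%Z -> (q %| f^`().[e])%Z.
Proof.
move=> hfe; pose G := \prod_(r <- rs) L r.
have hfeP : P (beta%:~R * G.[e%:~R]).
  rewrite -hornerZ -hf hornerZ horner_map /=.
  by apply: P_mull (OK_int K m) _ => //; apply/(P_intE hP hq hPq).
have hL r : r \in rs -> OK_poly (L r).
  by move=> hr; apply: OK_poly_lin; [apply: hU|apply: hV].
have hG : P (\prod_(r <- rs) (L r).[e%:~R]).
  rewrite -horner_prod; apply: P_int_factor qbeta _ hfeP.
  by apply: OK_horner; apply: OK_poly_prod.
have [r hr hPr] := P_prod hP (fun r hr => OK_horner e (hL r hr)) hG.
(* As [e] is rational, [sigma] carries the value of the factor of [r] to that of the factor of
   [sigma r]. *)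
have hPs : P (L (sigma r)).[e%:~R].
  have := P_frobenius hP hq hsig hPr.
  by rewrite !hornerE rmorphB rmorphM rmorph_int /= sU // sV.
have [s [ss _ E]] := prod_lin_split hr.
apply: (dvd_int_factor qm).
rewrite -(horner_map (intr : {rmorphism int -> K})) /= -deriv_map -hornerZ -derivZ.
rewrite hf E derivZ hornerZ; apply: P_mull (OK_int K beta) _ => //.
have hH : OK_poly (\prod_(r <- s) L r) by apply: OK_poly_prod => x /ss; exact: hL.
(* Each term of the product rule keeps one of the two factors undifferentiated. *)
rewrite derivM hornerD; apply: (P_add hP).
  rewrite hornerM; apply: (P_mull hP); first by apply/OK_horner/OK_deriv/hL.
  by rewrite hornerM; apply: (P_mulr hP hPs); apply: OK_horner.
rewrite hornerM; apply: (P_mulr hP hPr); apply/OK_horner/OK_deriv.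
by apply: OK_poly_mul hH; apply: hL; apply: srs.
Qed.

(** The same argument at infinity, where the factor of [r] takes the value [U r]. The size condition
    makes the leading coefficient of [f] the one in formal degree. *)
Lemma frobenius_double_root_infty : size f = (size rs).+1 ->
  (q %| lead_coef f)%Z -> (q %| f`_(size f).-2)%Z.
Proof.
move=> sf; rewrite lead_coefE sf /= => hfe; pose G := \prod_(r <- rs) L r.
have mfE k : m%:~R * (f`_k)%:~R = beta%:~R * G`_k.
  by rewrite -coefZ -hf coefZ coef_map.
have hfeP : P (beta%:~R * \prod_(r <- rs) U r).
  rewrite -coef_prod_lin -mfE.
  by apply: P_mull (OK_int K m) _ => //; apply/(P_intE hP hq hPq).
have hL r : r \in rs -> OK_poly (L r).
  by move=> hr; apply: OK_poly_lin; [apply: hU|apply: hV].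
have hG : P (\prod_(r <- rs) U r).
  apply: P_int_factor qbeta _ hfeP.
  by rewrite -coef_prod_lin; apply: OK_poly_prod.
have [r hr hPr] := P_prod hP hU hG.
have hPs : P (U (sigma r)) by rewrite -sU //; apply: (P_frobenius hP hq hsig hPr).
have [s [ss sz E]] := prod_lin_split hr.
apply: (dvd_int_factor qm).
have hH : OK_poly (\prod_(r <- s) L r) by apply: OK_poly_prod => x /ss; exact: hL.
rewrite mfE; apply: P_mull (OK_int K beta) _ => //.
(* The index is now [(size s).+1], one below the formal degree; one term contains [U r], the other
   [U (sigma r)]. *)
rewrite /G E sz /= coef_lin_mul; apply: (P_add hP).
  apply: (P_mulr hP hPr); apply: OK_poly_mul hH _.
  by apply: hL; apply: srs.
apply: (P_opp hP); apply: (P_mull hP); first exact: hV.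
rewrite coef_lin_mul [X in _ - _ * X]nth_default ?mulr0 ?subr0.
  exact: (P_mulr hP hPs).
exact: size_prod_lin.
Qed.

End LinearFactors.

(** * Integral factorizations indexed by the roots *)

Section FrobeniusRoots.
Variable K : splittingFieldType rat.
Local Notation OK := (@ring_of_integers K).

Lemma intr_field_eq0 (m : int) : (m%:~R == 0 :> K) = (m == 0).
Proof. by rewrite -(rmorph_int (in_alg K)) fmorph_eq0 intr_eq0. Qed.

Lemma size_map_intr (f : {poly int}) : size (map_poly intr f : {poly K}) = size f.
Proof.
apply: size_map_inj_poly; last by [].
by move=> x y /eqP; rewrite -subr_eq0 -rmorphB /= intr_field_eq0 subr_eq0 => /eqP.
Qed.

Lemma lead_coef_map_intr (f : {poly int}) :
  lead_coef (map_poly intr f : {poly K}) = (lead_coef f)%:~R.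
Proof. by rewrite lead_coefE size_map_intr coef_map. Qed.

(** With [deg f = d+1] and leading coefficient [b], the number [b r] is a root of the monic integral
    polynomial [b^d f(X/b)], whose part below the top degree is [N]. *)
Lemma OK_lead_root (f : {poly int}) (r : K) :
  root (map_poly intr f) r -> OK ((lead_coef f)%:~R * r).
Proof.
have [->|f0] := eqVneq f 0.
  by rewrite lead_coef0 mul0r => _; exact: (OK_int K 0).
move=> hr; set b := lead_coef f.
have hs : (1 < size f)%N.
  rewrite -size_map_intr; apply: root_size_gt1 hr.
  by rewrite -size_poly_gt0 size_map_intr size_poly_gt0.
set d := (size f).-2; have sf : size f = d.+2 by rewrite /d; slia.
pose N := \poly_(i < d.+1) (f`_i * b ^+ (d - i)).
exists ('X^(d.+1) + N).
  rewrite monicE lead_coefDl ?lead_coefXn //.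
  by rewrite size_polyXn ltnS size_poly.
rewrite rmorphD /= map_polyXn /root !hornerE.
rewrite (@horner_coef_wide _ d.+1); last first.
  apply/leq_sizeP => j hj; rewrite coef_map nth_default //.
  exact: leq_trans (size_poly _ _) hj.
have -> : \sum_(i < d.+1) (map_poly intr N)`_i * (b%:~R * r) ^+ i =
    b%:~R ^+ d * \sum_(i < d.+1) (f`_i)%:~R * r ^+ i.
  rewrite mulr_sumr; apply: eq_bigr => i _.
  rewrite coef_map coef_poly ltn_ord /= rmorphM rmorphXn /= exprMn.
  have -> : (b%:~R : K) ^+ d = b%:~R ^+ (d - i) * b%:~R ^+ i.
    by rewrite -exprD subnK // -ltnS ltn_ord.
  by ring.
move: hr; rewrite /root (@horner_coef_wide _ d.+2) ?size_map_intr ?sf //.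
rewrite big_ord_recr /= coef_map /=.
rewrite (_ : f`_d.+1 = b); last by rewrite /b lead_coefE sf.
under eq_bigr do rewrite coef_map /=.
move=> /eqP h; apply/eqP; set S := \sum_(_ < _) _ in h *.
have -> : S = - (b%:~R * r ^+ d.+1) by apply/eqP; rewrite -addr_eq0 h.
by rewrite exprMn !exprS; ring.
Qed.

(** The reversed polynomial [g] has leading coefficient [f_0] and root [1/r]. *)
Lemma OK_coef0_root (f : {poly int}) (r : K) : f`_0 != 0 ->
  root (map_poly intr f) r -> OK ((f`_0)%:~R / r).
Proof.
move=> f00 hr; pose g := \poly_(i < size f) f`_((size f).-1 - i).
have sf : (0 < size f)%N.
  by case: (posnP (size f)) f00 => // h; rewrite nth_default ?h.
have sg : size g = size f.
  by apply: size_poly_eq; rewrite subnn.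
have <- : lead_coef g = f`_0.
  by rewrite lead_coefE sg coef_poly prednK // leqnn subnn.
have r0 : r != 0.
  apply: contraTneq hr => ->; rewrite /root horner_coef0 coef_map /=.
  by rewrite intr_field_eq0.
apply: OK_lead_root; move: hr; rewrite /root.
rewrite !horner_coef !size_map_intr sg => /eqP h; apply/eqP.
apply: (mulfI (expf_neq0 (size f).-1 r0)); rewrite mulr0 -[RHS]h mulr_sumr.
rewrite (reindex_inj rev_ord_inj) /=; apply: eq_bigr => i _.
rewrite !coef_map coef_poly /=.
have hi := ltn_ord i; have -> : (size f - i.+1 < size f)%N by slia.
have -> : ((size f).-1 - (size f - i.+1) = i)%N by slia.
have -> : ((size f).-1 = (size f - i.+1) + i)%N by slia.
rewrite exprD exprVn; have := expf_neq0 (size f - i.+1) r0.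
by move: (r ^+ _) (r ^+ i) => x y x0; field.
Qed.

Lemma root_gal (f : {poly int}) (sigma : gal_of {:K}) r :
  root (map_poly intr f) r -> root (map_poly intr f) (sigma r).
Proof.
rewrite /root => /eqP h.
rewrite -[map_poly _ _](_ : map_poly sigma (map_poly intr f) = _).
  by rewrite horner_map h rmorph0.
by rewrite -map_poly_comp; apply: eq_map_poly => x /=; rewrite rmorph_int.
Qed.

(** Converts the condition on cycle lengths into [sigma r != r]. *)
Lemma cycle_length_fixed (sigma : gal_of {:K}) r :
  sigma r = r -> (cycle_length sigma r <= 1)%N.
Proof.
move=> h; rewrite /cycle_length.
suff E : {in enum <[sigma]>%g, forall tau : gal_of {:K}, tau r = r}.
  apply: (@leq_trans (size [:: r])) => //; apply: uniq_leq_size (undup_uniq _) _.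
  by move=> x; rewrite mem_undup => /mapP[tau ht ->]; rewrite E ?mem_head.
move=> tau; rewrite mem_enum => /cycleP[k ->]; elim: k => [|k IH].
  by rewrite expg0 gal_id.
by rewrite expgS galM ?memvf // h.
Qed.

(** If [q] does not divide the leading coefficient [b], the factors are [b X - b r]; otherwise, with
    [c = f_0], they are [c - (c/r) X]. Both are built from [r] and an integer alone, hence commute
    with the Galois action. *)
Lemma frobenius_factorization (f : {poly int}) (rs : seq K) (q : nat) :
  f != 0 -> map_poly intr f %= \prod_(r <- rs) ('X - r%:P) ->
  ~~ (q %| lead_coef f)%Z \/ ~~ (q %| f`_0)%Z ->
  exists U V : K -> K, exists beta : int,
  [/\ ~~ (q %| beta)%Z, forall r, r \in rs -> OK (U r) /\ OK (V r),
    forall (sigma : gal_of {:K}) r,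
      sigma (U r) = U (sigma r) /\ sigma (V r) = V (sigma r)
    & (beta ^+ size rs)%:~R *: map_poly intr f =
      beta%:~R *: \prod_(r <- rs) (U r *: 'X - (V r)%:P)].
Proof.
move=> f0 hrs hq; set b := lead_coef f; have b0 : b != 0 by rewrite lead_coef_eq0.
have E : map_poly intr f = (b%:~R : K) *: \prod_(r <- rs) ('X - r%:P).
  have := eqp_eq hrs; rewrite lead_coef_map_intr.
  by rewrite (monicP (monic_prod_XsubC _ _ _)) scale1r.
have hroot r : r \in rs -> root (map_poly intr f) r.
  by move=> hr; rewrite (eqp_root hrs) root_prod_XsubC.
case: hq => [hb|hb].
  exists (fun _ => b%:~R), (fun r => b%:~R * r), b; split=> // [r hr|sigma r|].
  - by split; [exact: OK_int|apply: OK_lead_root; apply: hroot].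
  - by rewrite rmorphM /= !rmorph_int.
  rewrite E scalerA mulrC -scalerA; congr (_ *: _).
  under [RHS]eq_bigr do rewrite polyCM mul_polyC -scalerBr.
  by rewrite scaler_prod big_const_seq count_predT iter_mulr_1 rmorphXn.
set c := f`_0 in hb *; have c0 : c != 0 by apply: contraNneq hb => ->.
(* Comparing constant terms gives the relation between [b] and [c] that balances the scalars at the
   end. *)
have Ec : c%:~R = (b%:~R : K) * \prod_(r <- rs) - r.
  have := congr1 (fun g : {poly K} => g.[0]) E.
  rewrite /= horner_coef0 coef_map hornerZ horner_prod => ->.
  by congr (_ * _); apply: eq_bigr => r _; rewrite hornerXsubC sub0r.
have r0 r : r \in rs -> r != 0.
  move=> hr; apply: contraTneq (hroot r hr) => ->.
  by rewrite /root horner_coef0 coef_map /= intr_field_eq0.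
exists (fun r => - c%:~R / r), (fun _ => - c%:~R), c; split=> // [r hr|sigma r|].
- split; last by apply/OK_opp/OK_int.
  by rewrite mulNr; apply/OK_opp/OK_coef0_root => //; apply: hroot.
- by split; rewrite ?fmorph_div rmorphN /= rmorph_int.
have -> : \prod_(r <- rs) ((- c%:~R / r) *: 'X - (- c%:~R)%:P) =
    (\prod_(r <- rs) (c%:~R / - r)) *: \prod_(r <- rs) ('X - r%:P).
  rewrite -scaler_prod big_seq [RHS]big_seq; apply: eq_bigr => r hr.
  rewrite scalerBr invrN mulrN -mulNr -[in X in _ = _ - X]mul_polyC -polyCM.
  by rewrite divfK ?r0.
rewrite E !scalerA; congr (_ *: _).
rewrite big_split /= prodfV big_const_seq count_predT iter_mulr_1 rmorphXn /=.
rewrite [X in _ = X * _]Ec; set p := \prod_(r <- rs) - r in Ec *.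
have p0 : p != 0.
  by apply: contraTneq c0 => p0; rewrite -intr_field_eq0 Ec p0 mulr0 eqxx.
by field.
Qed.

(** Every zero of [G] in P^1(F_q) is double, at a finite point [e] and at infinity: a Frobenius
    element in a derangement class moves every root. *)
Lemma frobenius_primes_dvd (G : {mpoly int[2]}) (q : nat) :
  let f := dehomog G in
  f != 0 -> is_splitting_field_of K G -> derangement_primes K G q ->
  ~~ (q %| lead_coef f)%Z \/ ~~ (q %| f`_0)%Z ->
  (forall e : int, (q %| f.[e])%Z -> (q %| f^`().[e])%Z) /\
  ((q %| lead_coef f)%Z -> (q %| f`_(size f).-2)%Z).
Proof.
move=> f f0 [rs hrs _] [C [_ hC] [hq _ [sigma [_ [P [hP hPq hsig]]] hsC]]] hqf.
have [U [V [beta [hb hUV hsUV E]]]] := frobenius_factorization f0 hrs hqf.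
have hroot r : (r \in rs) = root (map_poly intr f) r.
  by rewrite (eqp_root hrs) root_prod_XsubC.
have hU r : r \in rs -> OK (U r) by move=> /hUV[].
have hV r : r \in rs -> OK (V r) by move=> /hUV[].
have sU r : r \in rs -> sigma (U r) = U (sigma r) by case: (hsUV sigma r).
have sV r : r \in rs -> sigma (V r) = V (sigma r) by case: (hsUV sigma r).
have srs r : r \in rs -> sigma r \in rs by rewrite !hroot; apply: root_gal.
have derg r : r \in rs -> sigma r != r.
  rewrite hroot => /(hC _ _ hsC); apply: contraTneq => /cycle_length_fixed.
  by rewrite -leqNgt.
have hm : ~~ (q %| beta ^+ size rs)%Z.
  by rewrite dvdzE abszX Euclid_dvdX // negb_and -dvdzE hb.
split=> [e|].
  exact: (frobenius_double_root hq hP hPq hsig hU hV sU sV srs derg hm hb E).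
apply: (frobenius_double_root_infty hq hP hPq hsig hU hV sU srs derg hm hb E).
by rewrite -size_map_intr (eqp_size hrs) size_prod_XsubC.
Qed.

End FrobeniusRoots.

(** * Values of binary forms *)

Lemma resultant_scale (c : int) (p r : {poly int}) : c != 0 ->
  resultant (c *: p) (c *: r) =
  c ^+ ((size r).-1 + (size p).-1) * resultant p r.
Proof.
move=> c0; rewrite /resultant -detZ /Sylvester_mx !size_scale //.
congr (\det _); rewrite scale_col_mx; congr col_mx; apply/matrixP => i j.
  by rewrite !mxE /= -scalerAr coefZ.
by rewrite !mxE /= -scalerAr coefZ.
Qed.

(** With [n = deg f], the resultant scales by [c^(2n-1)], and the leading coefficient absorbs one
    factor [c]. *)
Lemma det_disc_mx_scale (c : int) (f : {poly int}) : c != 0 -> (1 < size f)%N ->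
  \det (disc_mx (c *: f)) = c ^+ (2 * (size f).-1 - 2) * \det (disc_mx f).
Proof.
move=> c0 sf; have f0 : f != 0 by rewrite -size_poly_gt0 ltnW.
have := resultant_deriv sf; have : (1 < size (c *: f))%N by rewrite size_scale.
move/resultant_deriv; have -> : resultant (c *: f) (c *: f)^`() =
    c ^+ ((size f^`()).-1 + (size f).-1) * resultant f f^`().
  by rewrite derivZ resultant_scale.
rewrite lead_coefZ => E E'.
have l0 : lead_coef f != 0 by rewrite lead_coef_eq0.
have cl0 : c * lead_coef f != 0 by rewrite mulf_neq0.
apply: (mulfI cl0); rewrite -E E'; move: (\det _) => D.
have -> : ((size f^`()).-1 + (size f).-1 = (2 * (size f).-1 - 2).+1)%N.
  by rewrite size_deriv_int; slia.
by rewrite exprS; ring.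
Qed.

Lemma discriminantE (f : {poly int}) : (1 < size f)%N ->
  discriminant f = (-1) ^+ 'C((size f).-1, 2) * \det (disc_mx f).
Proof.
move=> sf; have f0 : lead_coef f != 0 by rewrite lead_coef_eq0 -size_poly_gt0 ltnW.
by rewrite /discriminant resultant_deriv // mulrCA mulKz.
Qed.

Lemma dvdz_intr_Fp (q : nat) (m : int) : prime q ->
  (q %| m)%Z = (m%:~R == 0 :> 'F_q).
Proof. by move=> hq; rewrite (dvdz_pcharf (pchar_Fp hq)). Qed.

Lemma dvdn_absz (q : nat) (m : int) : (q %| `|m|)%N = (q %| m)%Z.
Proof. by rewrite dvdzE. Qed.

Lemma prime_dvdzM (q : nat) (a b : int) : prime q ->
  (q %| a * b)%Z = (q %| a)%Z || (q %| b)%Z.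
Proof. by move=> hq; rewrite !dvdzE abszM Euclid_dvdM. Qed.

Lemma prime_dvdz_prod (q : nat) (I : finType) (a : I -> int) : prime q ->
  (q %| \prod_i a i)%Z -> exists i, (q %| a i)%Z.
Proof.
move=> hq; rewrite dvdzE (big_morph absz abszM (erefl _)) Euclid_dvd_prod //.
by rewrite big_orE => /existsP[i hi]; exists i; rewrite dvdzE.
Qed.

Lemma expr_ord_split (R : nzRingType) (z : R) n (i : 'I_n.+1) :
  z ^+ n = z ^+ (n - i) * z ^+ i.
Proof. by rewrite -exprD subnK // -ltnS ltn_ord. Qed.

Section BinaryForm.
Variables (n : nat) (a : 'I_n.+1 -> int).
Local Notation f := (dehomog (binary_form a)).

Definition form_val (x y : int) : int :=
  \sum_(i < n.+1) a i * x ^+ i * y ^+ (n - i).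

Lemma eval2_binary_form x y : eval2 (binary_form a) x y = form_val x y.
Proof.
rewrite /eval2 /binary_form raddf_sum; apply: eq_bigr => i _ /=.
by rewrite !rmorphM !rmorphXn /= mevalC !mevalXU.
Qed.

Lemma dehomogM G H : dehomog (G * H) = dehomog G * dehomog H.
Proof. by rewrite /dehomog rmorphM. Qed.

Lemma dehomog_binary_form : f = \poly_(i < n.+1) a (inord i).
Proof.
rewrite poly_def /dehomog /binary_form raddf_sum; apply: eq_bigr => i _ /=.
rewrite !rmorphM !rmorphXn /= mmapC !mmapX !mmap1U /= inord_val mul_polyC.
by rewrite expr1n mulr1.
Qed.

Lemma coef_dehomog (i : 'I_n.+1) : f`_i = a i.
Proof. by rewrite dehomog_binary_form coef_poly ltn_ord inord_val. Qed.

Hypothesis ha : a ord_max != 0.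

Lemma size_dehomog : size f = n.+1.
Proof.
rewrite dehomog_binary_form; apply: size_poly_eq.
by rewrite (_ : inord n = ord_max) //; apply: val_inj; rewrite /= inordK.
Qed.

Lemma lead_coef_dehomog : lead_coef f = a ord_max.
Proof.
by rewrite lead_coefE size_dehomog -[n in f`_n]/(val (@ord_max n)) coef_dehomog.
Qed.

Lemma form_content_dvd i : (form_content a %| a i)%Z.
Proof.
rewrite /form_content; have: i \in index_enum 'I_n.+1 by rewrite mem_index_enum.
elim: (index_enum _) => // j s IH; rewrite inE big_cons => /orP[/eqP->|/IH h].
  exact: dvdz_gcdl.
exact: dvdz_trans (dvdz_gcdr _ _) h.
Qed.

Lemma form_content_neq0 : form_content a != 0.
Proof.
by apply: contraNneq ha => h; have := form_content_dvd ord_max; rewrite h dvd0z.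
Qed.

(** Writing [f = g h] with [g] the content, homogeneity shows that [discriminant_mod a] is, up to
    sign, the determinant for [h]; the remaining power of [g] is prime to [q]. *)
Lemma dvd_discriminant_mod (q : nat) : (1 < n)%N -> prime q ->
  ~~ (q %| form_content a)%Z -> (q %| \det (disc_mx f))%Z ->
  (q %| discriminant_mod a)%Z.
Proof.
move=> n1 hq hg hd; set g := form_content a in hg *.
have g0 : g != 0 := form_content_neq0.
have [h E] : exists h, f = g *: h.
  exists (\poly_(i < n.+1) (a (inord i) %/ g)%Z); apply/polyP => i.
  rewrite dehomog_binary_form coefZ !coef_poly; case: ltnP; rewrite ?mulr0 // => _.
  by rewrite mulrC divzK ?form_content_dvd.
have sh : size h = n.+1 by rewrite -size_dehomog E size_scale.
have sf : (1 < size f)%N by rewrite size_dehomog ltnS ltnW.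
rewrite /discriminant_mod discriminantE //.
move: hd; rewrite E det_disc_mx_scale ?sh ?ltnS ?(ltnW n1) //.
move: (\det _) => D; rewrite sh -/g /= => hd.
rewrite mulrCA mulKz ?expf_neq0 //; apply: dvdz_mull.
move: hd; rewrite prime_dvdzM // => /orP[|//].
by rewrite dvdzE abszX Euclid_dvdX // -dvdzE (negPf hg).
Qed.

Lemma form_val_root_mod (q : nat) (x y : int) : prime q ->
  ~~ (q %| y)%Z -> (q %| form_val x y)%Z -> exists e : int, (q %| f.[e])%Z.
Proof.
move=> hq; rewrite !dvdz_intr_Fp // => hy hF.
(* An integer lift of the quotient [x/y] in F_q; then [y^n f(e)] is congruent to the value of the
   form. *)
have [e Ee] : exists e : int, e%:~R = x%:~R / y%:~R :> 'F_q.
  by exists (val (x%:~R / y%:~R : 'F_q)); rewrite -pmulrn natr_Zp.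
exists e; rewrite dvdz_intr_Fp //; apply/eqP/(mulfI (expf_neq0 n hy)).
transitivity ((form_val x y)%:~R : 'F_q); last by rewrite mulr0 (eqP hF).
rewrite horner_coef size_dehomog !rmorph_sum /= mulr_sumr.
apply: eq_bigr => i _; rewrite coef_dehomog !rmorphM !rmorphXn /= Ee.
rewrite expr_div_n (expr_ord_split _ i).
have := expf_neq0 i hy; move: (_ ^+ i) (_ ^+ (n - i)) (_ ^+ i) => A B C hA.
by field.
Qed.

Lemma form_val_scale x y c : form_val (x * c) (y * c) = c ^+ n * form_val x y.
Proof.
rewrite /form_val mulr_sumr; apply: eq_bigr => i _.
by rewrite !exprMn (expr_ord_split c i); ring.
Qed.

(** Descent on the valuation: dividing [x] and [y] by [q] lowers it by exactly [n], until [q] no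
    longer divides the value. *)
Lemma dvd_logn_form_val (q : nat) : prime q -> (0 < n)%N ->
  (forall x y, (q %| form_val x y)%Z -> (q %| x)%Z && (q %| y)%Z) ->
  forall x y, form_val x y != 0 -> (n %| logn q `|form_val x y|)%N.
Proof.
move=> hq n0 hF x y; have [k] := ubnP (logn q `|form_val x y|).
elim: k x y => // k IH x y hk nz.
have [hd|hd] := boolP (q %| form_val x y)%Z; last first.
  by rewrite lognE hq absz_gt0 nz dvdn_absz (negPf hd) dvdn0.
move: hk nz; have /andP[/dvdzP[x' ->] /dvdzP[y' ->]] := hF _ _ hd.
rewrite form_val_scale mulf_eq0 negb_or => hk /andP[q0 nz].
move: hk; rewrite abszM abszX lognM ?absz_gt0 // ?expn_gt0 ?prime_gt0 // pfactorK //.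
by move=> hk; rewrite dvdn_addr // IH //; lia.
Qed.

End BinaryForm.

(** * Zeros of a product modulo a prime *)

Lemma double_root_prod (f g h : {poly int}) (d e : int) : f = g * h ->
  (d %| g.[e])%Z -> (d %| g^`().[e])%Z -> (d %| f^`().[e])%Z.
Proof.
by move=> -> h1 h2; rewrite derivM hornerD !hornerM rpredD ?dvdz_mulr.
Qed.

(** In the convolution for this coefficient, a term either contains one of the two top coefficients
    of [g] or has an index beyond the degree of [g] or [h]. *)
Lemma double_root_infty_prod (f g h : {poly int}) (d : int) : f = g * h ->
  f != 0 -> (1 < size f)%N ->
  (d %| lead_coef g)%Z -> (d %| g`_(size g).-2)%Z -> (d %| f`_(size f).-2)%Z.
Proof.
move=> E f0 sf h1 h2; have [g0 h0] : g != 0 /\ h != 0.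
  by move: f0; rewrite E mulf_eq0 negb_or => /andP[].
have sE : size f = (size g + size h).-1 by rewrite E size_mul.
have : (0 < size g)%N by rewrite size_poly_gt0.
have : (0 < size h)%N by rewrite size_poly_gt0.
move=> sh sg; rewrite (congr1 (fun F : {poly int} => F`_(size f).-2) E).
rewrite coefM rpred_sum // => i _.
case: (ltnP i (size g).-2) => hi.
  by rewrite [X in _ * X]nth_default ?mulr0 ?rpred0 //; slia.
apply: dvdz_mulr; have [->//|hi'] := eqVneq (nat_of_ord i) (size g).-1.
have [->//|hi''] := eqVneq (nat_of_ord i) (size g).-2.
by rewrite nth_default ?dvdz0 //; slia.
Qed.

(* The hypothesis on the factors says that a zero of [fj] in P^1(F_q) is double. *)
Lemma no_root_mod (u : nat) (fj : 'I_u -> {poly int}) (f : {poly int}) (q : nat) :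
  prime q -> (2 < size f)%N -> f = \prod_j fj j ->
  ~~ (q %| \det (disc_mx f))%Z ->
  ~~ (q %| lead_coef f)%Z \/ ~~ (q %| f`_0)%Z ->
  (forall j, fj j != 0 ->
    ~~ (q %| lead_coef (fj j))%Z \/ ~~ (q %| (fj j)`_0)%Z ->
    (forall e : int, (q %| (fj j).[e])%Z -> (q %| (fj j)^`().[e])%Z) /\
    ((q %| lead_coef (fj j))%Z -> (q %| (fj j)`_(size (fj j)).-2)%Z)) ->
  ~~ (q %| lead_coef f)%Z /\ forall e, ~~ (q %| f.[e])%Z.
Proof.
move=> hq sf E hD hlc hloc; have f0 : f != 0 by rewrite -size_poly_gt0; slia.
have Ej j : f = fj j * \prod_(i | i != j) fj i by rewrite E (bigD1 j).
have fj0 j : fj j != 0 by move: f0; rewrite (Ej j) mulf_eq0 negb_or => /andP[].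
(* The end coefficients of [f] are multiples of those of each factor, so the coprimality condition
   passes to the factors. *)
have hj j : ~~ (q %| lead_coef (fj j))%Z \/ ~~ (q %| (fj j)`_0)%Z.
  case: hlc => h; [left|right]; apply: contraNN h => h; rewrite (Ej j).
    by rewrite lead_coefM dvdz_mulr.
  by rewrite coef0M dvdz_mulr.
split=> [|e]; apply: contraNN hD => hd.
  have [j hdj] : exists j, (q %| lead_coef (fj j))%Z.
    by apply: prime_dvdz_prod => //; rewrite -lead_coef_prod -E.
  apply: disc_double_root_infty => //.
  apply: (double_root_infty_prod (Ej j)) => //; first by slia.
  by case: (hloc j) => // _; apply.
have [j hdj] : exists j, (q %| (fj j).[e])%Z.
  by apply: prime_dvdz_prod => //; rewrite -horner_prod -E.
apply: (disc_double_root sf hd); apply: (double_root_prod (Ej j)) => //.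
by case: (hloc j) => // h _; apply: h.
Qed.

(** * The valuation of a represented integer at an admissible prime *)

Theorem theorem3p2
  (n : nat) (a : 'I_n.+1 -> int) (ha : a ord_max != 0)
  (u : nat) (Fj : 'I_u -> {mpoly int[2]})
  (hirr : forall j, irreducible_elt (Fj j))
  (hfact : binary_form a = \prod_(j < u) Fj j)
  (K : 'I_u -> splittingFieldType rat)
  (hK : forall j, is_splitting_field_of (K j) (Fj j))
  (s t : nat) (p : 'I_s -> nat) (q l : 'I_t -> nat)
  (hqinj : injective q)
  (hq : forall i, admissible_prime a Fj K (q i))
  (hp : forall i, prime (p i) /\ ~ admissible_prime a Fj K (p i))
  (N : int)
  (hN : N = form_content a * (\prod_(i < s) p i)%N%:Z
              * (\prod_(i < t) q i ^ l i)%N%:Z)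
  (hrep : exists x y : int, eval2 (binary_form a) x y = N) :
  forall i : 'I_t, (n %| l i)%N.
Proof.
move=> i; have [qpr hder hcop] := hq i.
have hend : ~~ (q i %| a ord_max)%Z \/ ~~ (q i %| a ord0)%Z.
  have h b c : coprimez (q i) (b * c) -> ~~ (q i %| b)%Z.
    by rewrite coprimezMr => /andP[]; rewrite coprimezE prime_coprime.
  by case: hcop => /h; [left|right].
have hdisc : ~~ (q i %| discriminant_mod a)%Z.
  have h b c : coprimez (q i) (b * c) -> ~~ (q i %| c)%Z.
    by rewrite coprimezMr => /andP[_]; rewrite coprimezE prime_coprime.
  by case: hcop => /h.
have hg : ~~ (q i %| form_content a)%Z.
  by case: hend; apply: contraNN => /dvdz_trans; apply; exact: form_content_dvd.
have hp0 j : (0 < p j)%N by case: (hp j) => /prime_gt0.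
have hq0 j : (0 < q j)%N by case: (hq j) => /prime_gt0.
have P0 : (0 < \prod_(j < s) p j)%N by rewrite prodn_gt0.
have Q0 : (0 < \prod_(j < t) q j ^ l j)%N.
  by rewrite prodn_gt0 // => j; rewrite expn_gt0 hq0.
have g0 := form_content_neq0 ha.
have NN0 : N != 0.
  by rewrite hN !mulf_neq0 //; apply/eqP => -[] h; rewrite h in P0 Q0.
(* The content divides an end coefficient prime to [q i], no [p j] is admissible, and the [q j] are
   distinct, so only [q i ^ l i] contributes. *)
have lN : logn (q i) `|N| = l i.
  rewrite hN !abszM !lognM ?absz_gt0 // ?muln_gt0 ?absz_gt0 ?g0 //= -?lt0n //.
  have -> : logn (q i) `|form_content a| = 0%N.
    by rewrite lognE qpr absz_gt0 g0 dvdn_absz (negPf hg).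
  have -> : logn (q i) (\prod_(j < s) p j) = 0%N.
    rewrite lognE qpr P0 Euclid_dvd_prod // big_orE; case: existsP => // -[j].
    case: (hp j) => pj npj; rewrite dvdn_prime2 // => /eqP E.
    by case: npj; rewrite -E; exact: hq.
  rewrite (bigD1 i) //= lognM ?expn_gt0 ?hq0 //; last first.
    by rewrite prodn_cond_gt0 // => j _; rewrite expn_gt0 hq0.
  rewrite pfactorK //; have -> : logn (q i) (\prod_(j < t | j != i) q j ^ l j) = 0%N.
    rewrite lognE; case: ifP => // /and3P[_ _].
    rewrite Euclid_dvd_prod // big_orE => /existsP[j /andP[ji]].
    rewrite Euclid_dvdX // => /andP[]; case: (hq j) => qj _ _.
    by rewrite dvdn_prime2 // => /eqP/hqinj E; rewrite E eqxx in ji.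
  by rewrite !add0n addn0.
case: hrep => x [y]; rewrite eval2_binary_form => hF.
have [n0|npos] := posnP n.
  (* Here the form is the constant [a ord0], prime to [q i], and divisibility by 0 means
     [l i = 0]. *)
  subst n; have a0 : ~~ (q i %| a ord0)%Z by case: hend; rewrite ?(ord1 ord_max).
  rewrite dvd0n -lN -hF /form_val big_ord1 expr0 !mulr1.
  by rewrite lognE dvdn_absz (negPf a0) !andbF.
(* From degree 2 on, the size of [f] exceeds 2, as the double-zero lemmas for the discriminant
   require. *)
have [n1|n1] := leqP n 1; first by rewrite (_ : n = 1%N) ?dvd1n //; lia.
have sf := size_dehomog ha.
have fE : dehomog (binary_form a) = \prod_j dehomog (Fj j).
  by rewrite hfact; apply: big_morph; [exact: dehomogM|rewrite /dehomog rmorph1].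
have [hlc hroot] : ~~ (q i %| a ord_max)%Z /\
    forall e, ~~ (q i %| (dehomog (binary_form a)).[e])%Z.
  rewrite -lead_coef_dehomog //; apply: no_root_mod fE _ _ _ => //.
  - by rewrite sf.
  - by apply: contraNN hdisc; apply: dvd_discriminant_mod.
  - by rewrite lead_coef_dehomog // (coef_dehomog a ord0).
  move=> j fj0; apply: (@frobenius_primes_dvd (K j)) => //.
rewrite -lN -hF; apply: dvd_logn_form_val => //; last by rewrite hF.
move=> x' y' hd; have [hy|hy] := boolP (q i %| y')%Z; last first.
  by have [e he] := form_val_root_mod ha qpr hy hd; case/negP: (hroot e).
(* When [q i] divides [y'], every term but [a_n x'^n] is divisible by it, and [a_n] is not. *)
rewrite andbT; move: hd; rewrite /form_val big_ord_recr /= subnn mulr1.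
rewrite rpredDl; last first.
  rewrite rpred_sum // => k _; apply: dvdz_mull; apply: dvdz_exp => //.
  by rewrite subn_gt0.
by rewrite prime_dvdzM // (negPf hlc) /= dvdzE abszX Euclid_dvdX // => /andP[].
Qed.
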